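(* Let $(L,\leqslant)$ be an infinite linearly ordered set and $n$ an arbitrary natural number. For $k=0,1,\ldots,n$ let $I_k=\{\alpha\in\mathscr{OI}_n(L) : |\operatorname{dom}\alpha|\leq k\}$. Then $I_0\subseteq I_1\subseteq\cdots\subseteq I_n$ is a tight ideal series in the semigroup $\mathscr{OI}_n(L)$.
   Context: Natural numbers are positive integers. A partial order isomorphism of a linearly ordered set $(L,\leqslant)$ is an injective partial map $\alpha\colon L\rightharpoonup L$ with domain $\operatorname{dom}\alpha$ and range $\operatorname{ran}\alpha$ such that for all $x_1,x_2\in\operatorname{dom}\alpha$, $x_1\leqslant x_2$ implies $(x_1)\alpha\leqslant(x_2)\alpha$ (the empty partial map $\boldsymbol{0}$ is allowed). Maps are written on the right and composed from left to right: $(x)(\alpha\beta)=((x)\alpha)\beta$, with $\operatorname{dom}(\alpha\beta)=\{y\in\operatorname{dom}\alpha : (y)\alpha\in\operatorname{dom}\beta\}$. For a natural number $n$, $\mathscr{OI}_n(L)$ is the semigroup, under this composition, of all partial order isomorphisms $\alpha$ of $L$ with $|\operatorname{dom}\alpha|\leq n$. An infinite subset $D$ of a semigroup $S$ is called $\omega$-unstable if $sB\cup Bs\nsubseteq D$ for every $s\in D$ and every infinite subset $B\subseteq D$. A chain of (two-sided) ideals $J_0\subseteq J_1\subseteq\cdots\subseteq J_m=S$, $m\in\mathbb{N}$, of a semigroup $S$ is a tight ideal series of $S$ if $J_0$ is a finite ideal of $S$ and $J_k\setminus J_{k-1}$ is an $\omega$-unstable subset of $S$ for every $k=1,\ldots,m$.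 *)

(* Defs.v *)
From HB Require Import structures.
From mathcomp Require Import all_boot all_order.
From mathcomp Require Import boolp classical_sets functions cardinality.

Set Implicit Arguments.
Unset Strict Implicit.
Unset Printing Implicit Defensive.

Local Open Scope classical_set_scope.
Local Open Scope card_scope.

Section TightIdealSeries.
Variable S : semigroupType.
Implicit Types (D I : set S) (J : nat -> set S).

Definition omega_unstable D : Prop :=
  infinite_set D /\
  forall (s : S) (B : set S), D s -> infinite_set B -> B `<=` D ->
    ~ ([set (s * b)%g | b in B] `|` [set (b * s)%g | b in B] `<=` D).

Definition two_sided_ideal I : Prop :=
  I !=set0 /\ forall s x : S, I x -> I (s * x)%g /\ I (x * s)%g.

(* The series is J 0, ..., J m; the values J k with k > m are irrelevant. *)
Definition tight_ideal_series (m : nat) J : Prop :=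
  [/\ (0 < m)%N,
      forall k, (k <= m)%N -> two_sided_ideal (J k),
      forall k, (k < m)%N -> J k `<=` J k.+1,
      J m = setT &
      finite_set (J 0%N) /\
      forall k, (1 <= k <= m)%N -> omega_unstable (J k `\` J k.-1)].

End TightIdealSeries.

Section PartialOrderIsomorphisms.
Context {d : Order.disp_t} {L : orderType d}.
Implicit Types a b : L -> option L.

(* A partial map of L is a function L -> option L, undefined where it takes
   the value None. *)
Definition pdom a : set L := [set x | exists y, a x = Some y].

Definition partial_injective a : Prop :=
  forall x1 x2 y, a x1 = Some y -> a x2 = Some y -> x1 = x2.

Definition partial_monotone a : Prop :=
  forall x1 x2 y1 y2, a x1 = Some y1 -> a x2 = Some y2 ->
    (x1 <= x2)%O -> (y1 <= y2)%O.

Definition partial_order_iso a : Prop :=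
  partial_injective a /\ partial_monotone a.

(* [pcomp b a] applies a first: it is the left-to-right composite ab. *)
Lemma partial_order_iso_comp a b :
  partial_order_iso a -> partial_order_iso b -> partial_order_iso (pcomp b a).
Proof.
rewrite /pcomp => -[ia ma] [ib mb]; split.
  move=> x1 x2 y; case E1: (a x1) => [z1|] //= H1.
  case E2: (a x2) => [z2|] //= H2.
  by apply: (ia _ _ z1) => //; rewrite E2 (ib _ _ _ H2 H1).
move=> x1 x2 y1 y2; case E1: (a x1) => [z1|] //= H1.
case E2: (a x2) => [z2|] //= H2 le12.
exact: mb H1 H2 (ma _ _ _ _ E1 E2 le12).
Qed.

Lemma pdom_comp a b : pdom (pcomp b a) `<=` pdom a.
Proof. by move=> x [y]; rewrite /pcomp; case E: (a x) => [z|] //= _; exists z. Qed.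

End PartialOrderIsomorphisms.

Section OI.
Context {d : Order.disp_t}.

(* The boolean reflection of the defining property makes OI n L a subtype. *)
Record OI (n : nat) (L : orderType d) := MkOI {
  OI_val :> L -> option L;
  OI_valP : `[< partial_order_iso OI_val /\ pdom OI_val #<= `I_n >] }.

Variables (n : nat) (L : orderType d).

HB.instance Definition _ := [isSub for @OI_val n L].
HB.instance Definition _ := [Choice of OI n L by <:].

Lemma OI_mul_subproof (a b : OI n L) :
  `[< partial_order_iso (pcomp b a) /\ pdom (pcomp b a) #<= `I_n >].
Proof.
have /asboolP[isoa carda] := OI_valP a; have /asboolP[isob _] := OI_valP b.
apply/asboolP; split; first exact: partial_order_iso_comp.
exact: card_le_trans (subset_card_le (@pdom_comp _ _ a b)) carda.
Qed.

Definition OI_mul (a b : OI n L) : OI n L := MkOI (OI_mul_subproof a b).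

Lemma OI_mulA : associative OI_mul.
Proof.
move=> a b c; apply/val_inj/funext => x /=.
by rewrite /pcomp; case: (OI_val a x).
Qed.

HB.instance Definition _ := isSemigroup.Build (OI n L) OI_mulA.

Definition OI_ideal (k : nat) : set (OI n L) := [set a | pdom a #<= `I_k].

End OI.

(* Main.v *)
Require Import Defs.
From mathcomp Require Import all_boot all_order.
From mathcomp Require Import boolp classical_sets functions cardinality.
From mathcomp Require Import finmap.

(** The [I_k] are ideals because an injective partial map preserves the size of
    the sets that it transports, so the domain of a product is at most as large
    as the domain of either factor.  The layer [I_k] minus [I_(k-1)] consists
    of the maps whose domain, equivalently range, has exactly [k] points.

    Instability comes from rigidity inside a layer: the domain of [ab] is the
    part of [dom a] sent into [dom b], so if [a], [b] and [ab] all have [k]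
    points in their domain, no point may be lost and [ran a = dom b]
    ([layer_mul_pran]).  Hence if [sb] and [bs] both stay in the layer of [s]
    and [b], then [dom b = ran s] and [ran b = dom s].  The graph of such a
    [b] is a subset of the finite rectangle [ran s * dom s], which leaves only
    finitely many [b] ([finite_pgraph]).

    A layer is infinite because, [L] being infinite, the domains of finitely
    many of its members never exhaust [L]: some partial identity of the layer
    has its whole domain outside them ([infinite_layer]). *)

Set Implicit Arguments.
Unset Strict Implicit.
Unset Printing Implicit Defensive.

Local Open Scope classical_set_scope.
Local Open Scope card_scope.

(** * Finite sets *)

Lemma subset_card_le_eq (T : choiceType) (A B : set T) (k : nat) :
  A `<=` B -> B #<= `I_k.+1 -> ~ (A #<= `I_k) -> A = B.
Proof.
move=> AB Bk Ak.
have Bfin : finite_set B by apply/finite_set_leP; exists k.+1.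
have Afin : finite_set A := sub_finite_set AB Bfin.
apply: fset_set_inj => //; apply/eqP; rewrite finmap.eqEfcard.
apply/andP; split; first by rewrite -fset_set_sub.
apply: leq_trans (geq_card_fset_set Bk) _; rewrite ltnNge.
apply/negP => cA; apply: Ak.
have [m Am] := Afin; rewrite (card_fset_set Am) in cA.
by rewrite (card_le_eql Am) card_le_II.
Qed.

Lemma finite_subsets (T : choiceType) (X : set T) :
  finite_set X -> finite_set [set A : set T | A `<=` X].
Proof.
move=> Xfin.
apply: (@sub_finite_set _ _
  ((fun F : {fset T} => [set` F]) @` [set` fpowerset (fset_set X)])).
  move=> A /= AX; have Afin := sub_finite_set AX Xfin.
  exists (fset_set A); last exact: fset_setK.
  by rewrite /= fpowersetE -fset_set_sub.
exact: finite_image.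
Qed.

(** * Partial maps *)

Section PartialMaps.
Context {d : Order.disp_t} {L : orderType d}.
Implicit Types (a b : L -> option L) (A C : set L).

Definition pran a : set L := [set y | exists x, a x = Some y].

(** An injective partial map does not shrink the sets on which it is defined:
    it is an ordinary injection of [A] into the copy [some @` C] of [C]. *)
Lemma partial_injective_card a A C :
  partial_injective a -> A `<=` pdom a -> a @` A `<=` some @` C -> A #<= C.
Proof.
move=> ia Aa aAC; rewrite -card_le_some.
have aI : {in A &, injective a}.
  move=> x y /set_mem /Aa [z az] _ axy.
  by apply: (ia _ _ z) => //; rewrite -axy.
by rewrite -(card_le_eql (inj_card_eq aI)); exact: subset_card_le.
Qed.

Lemma pdom_card_pran a : partial_injective a -> pdom a #<= pran a.
Proof.
move=> ia; apply: (partial_injective_card ia) => //.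
by move=> _ [x [y axy] <-]; exists y => //; exists x.
Qed.

Lemma pran_card_pdom a : pran a #<= pdom a.
Proof.
rewrite -card_ge_some.
apply: card_le_trans (subset_card_le _) (card_image_le a (pdom a)).
by move=> _ [y [x axy] <-]; exists x => //; exists y.
Qed.

Lemma pdom_comp_card a b :
  partial_injective a -> pdom (pcomp b a) #<= pdom b.
Proof.
move=> ia; apply: (partial_injective_card ia); first exact: pdom_comp.
move=> _ [x [z xz] <-]; move: xz; rewrite /pcomp.
by case: (a x) => [y|] //= byz; exists y => //; exists z.
Qed.

(** A partial map is determined by its graph, a subset of the finite set
    [A `*` C]. *)
Lemma finite_pgraph A C : finite_set A -> finite_set C ->
  finite_set [set a | pdom a `<=` A /\ pran a `<=` C].
Proof.
move=> Afin Cfin.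
pose gr a : set (L * L) := [set p | a p.1 = Some p.2].
have grI : injective gr.
  move=> a b /predeqP e; apply/funext => x.
  case Ea: (a x) => [y|]; first by rewrite [RHS](proj1 (e (x, y)) Ea).
  by case Eb: (b x) => [y|] //; move: (proj2 (e (x, y)) Eb); rewrite /gr /= Ea.
apply: (@sub_finite_set _ _ (gr @^-1` [set G | G `<=` A `*` C])).
  move=> a [aA aC] [x y] /= axy; split; first by apply: aA; exists y.
  by apply: aC; exists x.
apply: finite_preimage; first by move=> a b _ _; exact: grI.
exact/finite_subsets/finite_setX.
Qed.

Definition partial_id A : L -> option L :=
  fun x => if `[< A x >] then Some x else None.

Lemma partial_idP A x y : partial_id A x = Some y <-> A x /\ x = y.
Proof.
rewrite /partial_id; case: asboolP => Ax; last by split=> // -[].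
by split=> [[]|[_ ->]].
Qed.

Lemma pdom_partial_id A : pdom (partial_id A) = A.
Proof.
apply/seteqP; split=> x; first by move=> [y /partial_idP[]].
by move=> Ax; exists x; exact/partial_idP.
Qed.

Lemma partial_id_iso A : partial_order_iso (partial_id A).
Proof.
split=> [x1 x2 y /partial_idP[_ ->] /partial_idP[_ ->]//|].
by move=> x1 x2 y1 y2 /partial_idP[_ <-] /partial_idP[_ <-].
Qed.

End PartialMaps.

(** * The ideals and their layers *)

Section Layers.
Context {d : Order.disp_t} (n : nat) (L : orderType d).
Implicit Types (a b : OI n L) (A : set L) (k : nat).

Lemma OI_injective a : partial_injective a.
Proof. by have /asboolP[[]] := OI_valP a. Qed.

Lemma OI_pdom_card a : pdom a #<= `I_n.
Proof. by have /asboolP[] := OI_valP a. Qed.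

Lemma OI_partial_id A : A #<= `I_n -> exists a, OI_val a = partial_id A.
Proof.
move=> An; have p : `[< partial_order_iso (partial_id A) /\
                        pdom (partial_id A) #<= `I_n >].
  by apply/asboolP; rewrite pdom_partial_id; split=> //; exact: partial_id_iso.
by exists (MkOI p).
Qed.

Lemma OI_ideal_two_sided k : two_sided_ideal (@OI_ideal d n L k).
Proof.
split; first have [|a aE] := @OI_partial_id set0; first exact: card_ge0.
  by exists a; rewrite /OI_ideal /= aE pdom_partial_id card_ge0.
rewrite /OI_ideal => s x /= xk; split.
  exact: card_le_trans (pdom_comp_card (OI_val x) (@OI_injective s)) xk.
exact: card_le_trans (subset_card_le (@pdom_comp _ _ _ _)) xk.
Qed.

Lemma OI_ideal_sub k : @OI_ideal d n L k `<=` @OI_ideal d n L k.+1.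
Proof. by move=> a ak; apply: card_le_trans ak _; rewrite card_le_II. Qed.

Lemma OI_ideal0_finite : finite_set (@OI_ideal d n L 0).
Proof.
have [a aE] := OI_partial_id (card_ge0 L `I_n).
apply: sub_finite_set (finite_set1 a) => b; rewrite /OI_ideal /= II0.
move=> /card_le0P b0; apply/val_inj/funext => x /=; rewrite aE.
rewrite /partial_id; case: asboolP => // _; case E: (OI_val b x) => [y|] //.
by have : pdom b x by [exists y]; rewrite b0.
Qed.

Let layer k : set (OI n L) := @OI_ideal d n L k.+1 `\` @OI_ideal d n L k.

Lemma layer_mul_pran k a b :
  layer k a -> layer k b -> layer k (a * b)%g -> pran a = pdom b.
Proof.
rewrite /layer /OI_ideal => -[/= ak1 ak] [/= bk1 _] [_ /= abk].
(* No point of [dom a] is lost, so [a] sends all of it into [dom b]. *)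
have dom_ab : pdom (pcomp b a) = pdom a.
  by apply: subset_card_le_eq ak1 abk; exact: pdom_comp.
apply: subset_card_le_eq bk1 _.
  move=> y [x axy].
  have : pdom (pcomp b a) x by rewrite dom_ab; exists y.
  by rewrite /pdom /pcomp /= axy.
move=> ran_k; apply: ak.
exact: card_le_trans (pdom_card_pran (@OI_injective a)) ran_k.
Qed.

Lemma infinite_layer k :
  infinite_set [set: L] -> (k < n)%N -> infinite_set (layer k).
Proof.
move=> Linf kn layer_fin.
pose X := \bigcup_(a in layer k) pdom (OI_val a).
have Xfin : finite_set X.
  apply: bigcup_finite => // a _.
  by apply/finite_set_leP; exists n; exact: OI_pdom_card.
have Xinf : infinite_set (~` X).
  by apply: cofinite_set_infinite => //; rewrite setCK.
have /card_subP[C Ck CX] : `I_k.+1 #<= ~` X.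
  by move/infiniteP: Xinf; apply: card_le_trans; exact: card_leT.
have [|a aE] := @OI_partial_id C; first by rewrite (card_le_eql Ck) card_le_II.
have la : layer k a.
  rewrite /layer /OI_ideal /=; split=> /=; rewrite aE pdom_partial_id.
    by rewrite (card_le_eql Ck).
  by rewrite (card_le_eql Ck) card_le_II ltnn.
have /set0P[x Cx] : C != set0.
  apply/eqP => C0; move: Ck; rewrite C0 card_eq_sym card_eq0 => /eqP Ik0.
  by have : `I_k.+1 0%N by []; rewrite Ik0.
by apply: (CX x Cx); exists a; rewrite // aE pdom_partial_id.
Qed.

Lemma layer_omega_unstable k :
  infinite_set [set: L] -> (k < n)%N -> omega_unstable (layer k).
Proof.
move=> Linf kn; split; first exact: infinite_layer.
move=> s B ls Binf Bl sBs; apply: Binf.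
have dom_fin : finite_set (pdom s).
  by apply/finite_set_leP; exists n; exact: OI_pdom_card.
have ran_fin : finite_set (pran s) := card_le_finite (pran_card_pdom s) dom_fin.
apply: (@sub_finite_set _ _ (@OI_val d n L @^-1`
    [set b | pdom b `<=` pran s /\ pran b `<=` pdom s])); last first.
  apply: finite_preimage (finite_pgraph ran_fin dom_fin).
  by move=> a b _ _; exact: val_inj.
move=> b Bb /=; have lb := Bl _ Bb.
by split; [rewrite (layer_mul_pran ls lb)|rewrite (layer_mul_pran lb ls)] => //;
  apply: sBs; [left|right]; exists b.
Qed.

End Layers.

Theorem mainTheorem4 (d : Order.disp_t) (L : orderType d)
    (Linf : infinite_set [set: L]%classic) (n : nat) (n_gt0 : (0 < n)%N) :
  @tight_ideal_series (OI n L) n (fun k : nat => @OI_ideal d n L k).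
Proof.
split=> //.
- by move=> k _; exact: OI_ideal_two_sided.
- by move=> k _; exact: OI_ideal_sub.
- by apply/seteqP; split=> // a _; exact: OI_pdom_card.
- split; first exact: OI_ideal0_finite.
  by case=> // k kn; exact: layer_omega_unstable.
Qed.
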